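(* Let $\mathbf{N}$ be a weight sequence such that $\sup_{k\in\mathbb{N}}\sqrt[k]{N_k/N_{k-1}}<\infty$ and $\gamma(\mathbf{N})>0$, and let $G_{\mathbf{N}}$ be an optimal $\{\mathbf{N}\}$-flat function in a sector $S_\gamma$ with $0<\gamma<\gamma(\mathbf{N})$. Put $\Phi_{\mathbf{N}}(t)=G_{\mathbf{N}}(1/t)$ for $t>0$. Let $x_0\in\mathbb{R}^n$ and $\xi_0\in\mathbb{R}^n$ with $|\xi_0|=1$, and set $$g(x)=\int_0^\infty \Phi_{\mathbf{N}}(t)\,e^{it\,\xi_0\cdot(x-x_0)}\,dt,\qquad x\in\mathbb{R}^n.$$ Then $g$ is a smooth function on $\mathbb{R}^n$ and $g$ is an optimal function of the class $\mathcal{E}^{\{\mathbf{N}\}}(\mathbb{R}^n)$.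
   Context: $\mathbb{N}=\{1,2,\dots\}$. A weight sequence is a sequence $\mathbf{M}=(M_k)_{k\in\mathbb{N}_0}$ of positive numbers with $M_0=1\le M_1$ such that $\mu_k=M_k/M_{k-1}$ ($k\ge1$) is increasing and $\mu_k\to\infty$. Index: $\gamma(\mathbf{M})=\sup\{\gamma>0: (\mu_k/k^\gamma)_{k\ge1}\text{ is almost increasing}\}\in[0,\infty]$ (with $\sup\emptyset=0$), where $(L_k)_k$ is almost increasing if there is $C>0$ with $L_j\le CL_k$ for all $j\le k$. Let $h_{\mathbf{M}}(t)=\inf_{k\in\mathbb{N}_0}t^kM_k$ for $t>0$, $h_{\mathbf{M}}(0)=0$. Let $\mathcal{R}$ be the Riemann surface of the logarithm and $S_\gamma=\{z\in\mathcal{R}:|\arg z|<\gamma\pi/2\}$. A holomorphic function $G$ on $S_\gamma$ is an optimal $\{\mathbf{M}\}$-flat function in $S_\gamma$ if there are constants $A_1,B_1,A_2,B_2>0$ such that $A_1h_{\mathbf{M}}(B_1t)\le G(t)$ for all $t>0$ (in particular $G(t)$ is real and positive there) and $|G(z)|\le A_2h_{\mathbf{M}}(B_2|z|)$ for all $z\in S_\gamma$. $\mathcal{E}^{\{\mathbf{M}\}}(\Omega)$ is the set of smooth $f$ on the open set $\Omega\subseteq\mathbb{R}^n$ such that for every compact $K\subset\Omega$ there are $C,h>0$ with $\sup_{x\in K}|D^\alpha f(x)|\le Ch^{|\alpha|}M_{|\alpha|}$ for all $\alpha\in\mathbb{N}_0^n$. For weight sequences, $\mathbf{T}\preceq\mathbf{N}$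 means there are $C,h>0$ with $T_k\le Ch^kN_k$ for all $k\in\mathbb{N}_0$; $\mathbf{T}\precnapprox\mathbf{N}$ means $\mathbf{T}\preceq\mathbf{N}$ but not $\mathbf{N}\preceq\mathbf{T}$. A smooth function $g$ on $\Omega$ is an optimal function of $\mathcal{E}^{\{\mathbf{N}\}}(\Omega)$ if $g\in\mathcal{E}^{\{\mathbf{N}\}}(\Omega)$ but $g\notin\mathcal{E}^{\{\mathbf{T}\}}(\Omega)$ for every weight sequence $\mathbf{T}\precnapprox\mathbf{N}$. *)

(* Defs.v *)
From HB Require Import structures.
From mathcomp Require Import all_boot all_order all_algebra.
From mathcomp Require Import complex.
From mathcomp Require Import all_classical all_reals all_analysis.

Set Implicit Arguments.
Unset Strict Implicit.
Unset Printing Implicit Defensive.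

Import Order.TTheory GRing.Theory Num.Theory.
Import numFieldNormedType.Exports.

Local Open Scope classical_set_scope.
Local Open Scope ring_scope.

Section WeightSequences.
Variable R : realType.
Implicit Types M T N : nat -> R.

(* Meaningful for k >= 1 only. *)
Definition mu M (k : nat) : R := M k / M k.-1.

(* "Increasing" is understood in the weak sense (log-convexity of M). *)
Definition weight_sequence M : Prop :=
  [/\ forall k, 0 < M k,
      M 0%N = 1,
      1 <= M 1%N,
      forall j k, (1 <= j <= k)%N -> mu M j <= mu M k
    & mu M k @[k --> \oo] --> +oo].

(* Sequences indexed by k >= 1: the value at 0 is ignored. *)
Definition almost_increasing (L : nat -> R) : Prop :=
  exists C : R, 0 < C /\ forall j k, (1 <= j <= k)%N -> L j <= C * L k.

(* 0 is added so that the supremum of the empty set is 0 and not -oo. *)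
Definition gamma_index M : \bar R :=
  ereal_sup (0%E |` [set gamma%:E | gamma in
    [set gamma : R | 0 < gamma /\
       almost_increasing (fun k => mu M k / k%:R `^ gamma)]]).

Definition h_fun M (t : R) : R :=
  if 0 < t then inf (range (fun k : nat => t ^+ k * M k)) else 0.

Definition seq_le T N : Prop :=
  exists C h : R, [/\ 0 < C, 0 < h & forall k, T k <= C * h ^+ k * N k].

Definition seq_lt T N : Prop := seq_le T N /\ ~ seq_le N T.

End WeightSequences.

Section FlatFunctions.
Variable R : realType.

(* A point of the Riemann surface of the logarithm is given by its modulus
   and its argument: it is the set of the pairs (r, theta) with r > 0. *)
Definition log_sector (gamma : R) : set (R * R) :=
  [set z | 0 < z.1 /\ `|z.2| < gamma * pi / 2].

(* Inverse of the global chart log (r, theta) = ln r + i theta, which is what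
   defines the complex structure of the surface. *)
Definition log_surface_exp (w : R[i]) : R * R :=
  (expR (complex.Re w), complex.Im w).

(* Complex differentiability in the chart log, on the image of the sector. *)
Definition holomorphic_on_sector (gamma : R) (G : R * R -> R[i]) : Prop :=
  forall w : R[i], log_sector gamma (log_surface_exp w) ->
    derivable ((G \o log_surface_exp) : R[i]^o -> R[i]^o) w 1.

(* The order of R[i] is the partial one: a%:C <= z says that z is real and
   at least a. *)
Definition optimal_flat (M : nat -> R) (gamma : R) (G : R * R -> R[i]) : Prop :=
  holomorphic_on_sector gamma G /\
  exists A1 B1 A2 B2 : R,
    [/\ [/\ 0 < A1, 0 < B1, 0 < A2 & 0 < B2],
        forall t : R, 0 < t -> (A1 * h_fun M (B1 * t))%:C%C <= G (t, 0)
      & forall z, log_sector gamma z ->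
          `|G z| <= (A2 * h_fun M (B2 * z.1))%:C%C].

End FlatFunctions.

Section UltradifferentiableFunctions.
Variables (R : realType) (n : nat).
Implicit Types (f : 'rV[R]_n -> R) (g : 'rV[R]_n -> R[i]).
Implicit Types (Omega K : set 'rV[R]_n).

Definition partial (i : 'I_n) f : 'rV[R]_n -> R :=
  fun x => 'D_(delta_mx 0 i : 'rV[R]_n) f x.

(* Iterated partial derivatives in an arbitrary order. *)
Definition partials (s : seq 'I_n) f : 'rV[R]_n -> R := foldr partial f s.

Definition smooth_real Omega f : Prop :=
  forall (s : seq 'I_n) x, Omega x ->
    {for x, continuous (partials s f)} /\
    forall i : 'I_n, derivable (partials s f) x (delta_mx 0 i : 'rV[R]_n).

Definition smooth Omega g : Prop :=
  smooth_real Omega (@complex.Re R \o g) /\ smooth_real Omega (@complex.Im R \o g).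

Definition mlen (alpha : {ffun 'I_n -> nat}) : nat := (\sum_i alpha i)%N.

Definition multi_partial (alpha : {ffun 'I_n -> nat}) f : 'rV[R]_n -> R :=
  foldr (fun i => iter (alpha i) (partial i)) f (enum 'I_n).

Definition multi_partialC (alpha : {ffun 'I_n -> nat}) g (x : 'rV[R]_n) : R[i] :=
  (multi_partial alpha (@complex.Re R \o g) x +i*
   multi_partial alpha (@complex.Im R \o g) x)%C.

Definition ultra_class (M : nat -> R) Omega g : Prop :=
  smooth Omega g /\
  forall K, compact K -> K `<=` Omega ->
    exists C h : R, [/\ 0 < C, 0 < h &
      forall (alpha : {ffun 'I_n -> nat}) x, K x ->
        `|multi_partialC alpha g x|
          <= (C * h ^+ mlen alpha * M (mlen alpha))%:C%C].

Definition optimal_function (N : nat -> R) Omega g : Prop :=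
  [/\ smooth Omega g,
      ultra_class N Omega g
    & forall T : nat -> R, weight_sequence T -> seq_lt T N ->
        ~ ultra_class T Omega g].

(* The library's norm on 'rV[R]_n is the sup norm, hence these. *)
Definition dotv (u v : 'rV[R]_n) : R := \sum_(i < n) u 0 i * v 0 i.

Definition norm2 (u : 'rV[R]_n) : R := Num.sqrt (dotv u u).

End UltradifferentiableFunctions.

Section OscillatoryIntegral.
Variable R : realType.

Definition expi (theta : R) : R[i] := (cos theta +i* sin theta)%C.

Definition cintegrable (D : set R) (F : R -> R[i]) : Prop :=
  (@lebesgue_measure R).-integrable D (fun t => (complex.Re (F t))%:E) /\
  (@lebesgue_measure R).-integrable D (fun t => (complex.Im (F t))%:E).

Definition cintegral (D : set R) (F : R -> R[i]) : R[i] :=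
  (\int[@lebesgue_measure R]_(t in D) complex.Re (F t) +i*
   \int[@lebesgue_measure R]_(t in D) complex.Im (F t))%C.

(* Phi (t) = G (1 / t), the ray t > 0 being the points of argument 0. *)
Definition Phi_of (G : R * R -> R[i]) (t : R) : R[i] := G (t^-1, 0).

Definition osc_integrand (n : nat) (G : R * R -> R[i]) (x0 xi0 x : 'rV[R]_n)
    (t : R) : R[i] :=
  Phi_of G t * expi (t * dotv xi0 (x - x0)).

Definition osc_integral (n : nat) (G : R * R -> R[i]) (x0 xi0 x : 'rV[R]_n)
    : R[i] :=
  cintegral `]0, +oo[ (osc_integrand G x0 xi0 x).

End OscillatoryIntegral.

(* Main.v *)
Require Import Defs.
From HB Require Import structures.
From mathcomp Require Import all_boot all_order all_algebra.
From mathcomp Require Import complex.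
From mathcomp Require Import all_classical all_reals all_analysis.
From mathcomp Require Import measurable_realfun ring.

(** With [phi t = G (1 / t)], real and nonnegative for [t > 0], the function is
[g x = J (xi0 . (x - x0))] where [J u] is the integral of [phi t * exp (i t u)],
so differentiating under the integral sign expresses every partial derivative
of order [k] through the [k]-th moment integrand [t ^ k * phi t].
For the upper bound, [phi t <= A h_N (B / t) <= A (B / t) ^ j N_j] with [j = k]
and [j = k + 2] dominates [t ^ k * phi t] by a multiple of [1 / (1 + t ^ 2)],
and the growth condition on the quotients [mu_k] turns [N_(k+2)] back into
[N_k] up to a geometric factor.
For optimality, at [x0] the exponential disappears and the [k]-th derivative in
a direction [e_j] with [xi0_j <> 0] has modulus [|xi0_j| ^ k] times the [k]-th
moment of [phi >= 0]. Since [h_N s >= N_k / mu_(k+1) ^ k] for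
[s >= 1 / mu_(k+1)], restricting to [B mu_(k+1) / 2 < t <= B mu_(k+1)] bounds
this moment below by [c h ^ k N_k]; hence [g] in the class of [T] forces
[N <= T]. *)

Set Implicit Arguments.
Unset Strict Implicit.
Unset Printing Implicit Defensive.
Import Order.TTheory GRing.Theory Num.Theory.
Import numFieldNormedType.Exports.
Local Open Scope classical_set_scope.
Local Open Scope ring_scope.

(** * Half-line integrals dominated by [1 / (1 + t ^ 2)], and differentiation under the integral
    sign *)

Section RapidDecay.
Variable R : realType.
Local Notation mu := (@lebesgue_measure R).
Implicit Types (f phi : R -> R) (C theta u : R).

Lemma integrable_oneDsqrV :
  mu.-integrable `]0, +oo[ (fun t : R => ((oneDsqr t)^-1)%:E).
Proof.
apply: (@integrableS _ _ _ mu `[0, +oo[) => //.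
  by apply: subset_itvr; rewrite bnd_simp.
apply/integrableP; split.
  apply/measurable_EFinP; apply: measurable_funTS.
  by apply: continuous_measurable_fun; exact: continuous_oneDsqrV.
under eq_integral do rewrite gee0_abs ?lee_fin ?invr_ge0 ?(le_trans ler01)//.
by rewrite integral0y_oneDsqr ltry.
Qed.

Lemma Rintegral_oneDsqrV :
  \int[mu]_(t in `]0, +oo[) (oneDsqr t)^-1 = pi / 2.
Proof.
rewrite Rintegral_itv_obnd_cbnd; first by rewrite /Rintegral integral0y_oneDsqr.
exact: integrable_oneDsqrV.
Qed.

Lemma integrable_dominated f C : measurable_fun (`]0, +oo[ : set R) f ->
  (forall t, 0 < t -> `|f t| <= C / oneDsqr t) ->
  mu.-integrable `]0, +oo[ (EFin \o f).
Proof.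
move=> mf fC; apply: (@le_integrable _ _ _ mu _ _ _ (fun t => (C / oneDsqr t)%:E))
  => //.
- exact/measurable_EFinP.
- move=> t; rewrite /= in_itv/= andbT => t0.
  by rewrite lee_fin (le_trans (fC t t0))// ler_norm.
- exact: integrableZl integrable_oneDsqrV.
Qed.

Lemma Rintegral_dominated f C : measurable_fun (`]0, +oo[ : set R) f ->
  (forall t, 0 < t -> `|f t| <= C / oneDsqr t) ->
  `|\int[mu]_(t in `]0, +oo[) f t| <= C * (pi / 2).
Proof.
move=> mf fC; have intf := integrable_dominated mf fC.
apply: (le_trans (le_normr_Rintegral _ intf)) => //.
rewrite -Rintegral_oneDsqrV -RintegralZl//; last exact: integrable_oneDsqrV.
apply: le_Rintegral => //.
- exact: integrable_norm.
- exact: integrableZl integrable_oneDsqrV.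
- by move=> t; rewrite /= in_itv/= andbT => /fC.
Qed.

(** Since every [k] is allowed, this amounts to boundedness of all [phi t * t ^ k] on [t > 0]; the
    factor [1 / oneDsqr t] hands over an integrable majorant directly. *)
Definition rapidly_decreasing phi : Prop :=
  forall k : nat, exists C, forall t, 0 < t -> `|phi t| * t ^+ k <= C / oneDsqr t.

(* The phase [theta] covers cosine and sine at once, and makes the family stable
   under derivation: [d/du] raises [k] by one and [theta] by [pi / 2]. *)
Definition osc_moment phi (k : nat) theta u : R :=
  \int[mu]_(t in `]0, +oo[) (phi t * t ^+ k * cos (t * u + theta)).

Variable phi : R -> R.
Hypothesis mphi : measurable_fun (`]0, +oo[ : set R) phi.

Lemma measurable_osc_moment k theta u :
  measurable_fun (`]0, +oo[ : set R) (fun t => phi t * t ^+ k * cos (t * u + theta)).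
Proof.
apply: measurable_funM; first by apply: measurable_funM => //; exact: measurable_funTS.
apply: measurable_funTS; apply: measurableT_comp.
  apply: continuous_measurable_fun; exact: continuous_cos.
by apply: measurable_funD => //; exact: measurable_funM.
Qed.

Lemma osc_moment_dominated k C theta u :
  (forall t, 0 < t -> `|phi t| * t ^+ k <= C / oneDsqr t) ->
  forall t, 0 < t -> `|phi t * t ^+ k * cos (t * u + theta)| <= C / oneDsqr t.
Proof.
move=> phiC t t0; apply: le_trans (phiC t t0).
rewrite !normrM (ger0_norm (exprn_ge0 _ (ltW t0))) ler_piMr//.
  by rewrite mulr_ge0 ?exprn_ge0// ltW.
by rewrite ler_norml cos_geN1 cos_le1.
Qed.

Lemma osc_moment_le k C theta u :
  (forall t, 0 < t -> `|phi t| * t ^+ k <= C / oneDsqr t) ->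
  `|osc_moment phi k theta u| <= C * (pi / 2).
Proof.
move=> phiC; apply: Rintegral_dominated; first exact: measurable_osc_moment.
exact: osc_moment_dominated.
Qed.

Hypothesis dphi : rapidly_decreasing phi.

Lemma integrable_osc_moment k theta u :
  mu.-integrable `]0, +oo[
    (EFin \o (fun t => phi t * t ^+ k * cos (t * u + theta))).
Proof.
have [C phiC] := dphi k.
apply: (integrable_dominated _ (osc_moment_dominated theta u phiC)).
exact: measurable_osc_moment.
Qed.

(** The derivative of the integrand in [u] is the integrand of order [k.+1], because
    [- sin y = cos (y + pi / 2)]. As [|cos| <= 1], decay at order [k.+1] gives a majorant
    independent of [u], so any neighbourhood of [u] will do. *)
Lemma is_derive_osc_moment k theta u :
  is_derive u 1 (osc_moment phi k theta) (osc_moment phi k.+1 (theta + pi / 2) u).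
Proof.
pose f (v t : R) := phi t * t ^+ k * cos (t * v + theta).
have df (v t : R) :
    is_derive v 1 (f ^~ t) (phi t * t ^+ k.+1 * cos (t * v + (theta + pi / 2))).
  have df1 : is_derive v 1 (fun v : R => t * v + theta) t.
    by apply: is_derive_eq; rewrite addr0 /GRing.scale/= mulr1.
  have df2 := @is_derive1_comp _ cos _ v _ _ (is_derive_cos (t * v + theta)) df1.
  have H := @is_deriveZ _ _ _ _ (phi t * t ^+ k) _ _ _ df2.
  apply: (@is_derive_eq _ _ _ _ _ _ _ _ H).
  by rewrite addrA cosDpihalf exprSr /GRing.scale/=; ring.
have [C phiC] := dphi k.+1.
have intf (v : R) : v \in `]u - 1, u + 1[ -> mu.-integrable `]0, +oo[ (EFin \o f v).
  by move=> _; exact: integrable_osc_moment.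
have dfE (v t : R) : partial1of2 f v t =
    phi t * t ^+ k.+1 * cos (t * v + (theta + pi / 2)).
  by rewrite partial1of2E; apply: derive_val.
have uI : u \in `]u - 1, u + 1[ by rewrite in_itv/= ltrBlDr ltrDl ltr01.
(* The majorant has to be nonnegative everywhere, and [C] comes without a sign. *)
pose g (t : R) := `|C| / oneDsqr t.
have g_ge0 t : 0 <= g t by rewrite mulr_ge0// invr_ge0 (le_trans ler01).
have intg : mu.-integrable `]0, +oo[ (EFin \o g).
  apply: (@integrable_dominated _ `|C|).
    apply: measurable_funM => //; apply: measurable_funTS.
    by apply: continuous_measurable_fun; exact: continuous_oneDsqrV.
  by move=> t t0; rewrite ger0_norm.
have fg (v t : R) : v \in `]u - 1, u + 1[ -> `]0, +oo[%classic t ->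
    `|partial1of2 f v t| <= g t.
  move=> _; rewrite /= in_itv/= andbT => t0; rewrite dfE.
  apply: (le_trans (osc_moment_dominated _ _ phiC t0)).
  by rewrite ler_wpM2r ?ler_norm// invr_ge0 (le_trans ler01).
have df' (v t : R) : v \in `]u - 1, u + 1[ -> `]0, +oo[%classic t ->
    derivable (f ^~ t) v 1.
  by move=> _ _; exact: ex_derive.
apply: DeriveDef.
  exact: (@derivable_under_integral _ _ _ mu f _ (measurable_itv _) u _ _
    uI intf df' g g_ge0 intg fg).
rewrite -derive1E (@differentiation_under_integral _ _ _ mu f _
  (measurable_itv _) u _ _ uI intf df' g g_ge0 intg fg).
by apply: eq_Rintegral => t _; rewrite dfE.
Qed.

Lemma continuous_osc_moment k theta : continuous (osc_moment phi k theta).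
Proof.
move=> u; apply: differentiable_continuous; apply/derivable1_diffP.
by have /@ex_derive := is_derive_osc_moment k theta u.
Qed.

End RapidDecay.

(** * Multi-indices as lists of directions, and derivatives of functions of the phase *)

Section MultiIndices.
Variables (R : realType) (n : nat).
Implicit Types (f : 'rV[R]_n -> R) (alpha : {ffun 'I_n -> nat}).

Definition index_seq alpha : seq 'I_n :=
  flatten [seq nseq (alpha i) i | i <- enum 'I_n].

(** Transfers to multi-indices what is proved by induction on lists of directions. *)
Lemma multi_partialE alpha f : multi_partial alpha f = partials (index_seq alpha) f.
Proof.
rewrite /multi_partial /index_seq; elim: (enum 'I_n) => //= i s ->.
by rewrite /partials foldr_cat; elim: (alpha i) => //= k ->.
Qed.

Lemma prod_index_seq alpha (a : 'I_n -> R) :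
  \prod_(i <- index_seq alpha) a i = \prod_i a i ^+ alpha i.
Proof.
rewrite /index_seq big_flatten big_map big_enum; apply: eq_bigr => i _.
by rewrite big_nseq -Monoid.iteropE.
Qed.

Lemma size_index_seq alpha : size (index_seq alpha) = mlen alpha.
Proof.
rewrite /index_seq size_flatten /shape -map_comp sumnE big_map big_enum.
by apply: eq_bigr => i _ /=; rewrite size_nseq.
Qed.

Lemma dotv_delta (xi : 'rV[R]_n) i : dotv xi (delta_mx 0 i) = xi 0 i.
Proof.
rewrite /dotv (bigD1 i)//= mxE !eqxx mulr1 big1 ?addr0// => j ji.
by rewrite mxE (negPf ji) andbF mulr0.
Qed.

Lemma dotvD (xi x y : 'rV[R]_n) : dotv xi (x + y) = dotv xi x + dotv xi y.
Proof. by rewrite -big_split; apply: eq_bigr => i _; rewrite mxE mulrDr. Qed.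

Lemma dotvZ (xi x : 'rV[R]_n) h : dotv xi (h *: x) = h * dotv xi x.
Proof. by rewrite /dotv mulr_sumr; apply: eq_bigr => i _; rewrite mxE mulrCA. Qed.

Lemma norm_coord_le1 (xi : 'rV[R]_n) i : norm2 xi = 1 -> `|xi 0 i| <= 1.
Proof.
move=> xi1; rewrite -(@expr_le1 _ 2)// -normrX ger0_norm ?sqr_ge0//.
have xiE : dotv xi xi = 1.
  rewrite -[LHS]sqr_sqrtr; first by rewrite -/(norm2 xi) xi1 expr1n.
  by apply: sumr_ge0 => j _; rewrite -expr2 sqr_ge0.
rewrite -xiE /dotv (bigD1 i)//= -expr2 lerDl.
by apply: sumr_ge0 => j _; rewrite -expr2 sqr_ge0.
Qed.

Lemma norm2_1_neq0 (xi : 'rV[R]_n) : norm2 xi = 1 -> exists i, xi 0 i != 0.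
Proof.
move=> xi1; apply/existsP; rewrite -[X in is_true X]negbK negb_exists.
apply/negP => /forallP xi0; move: xi1; rewrite /norm2 /dotv big1.
  by rewrite sqrtr0 => /eqP; rewrite eq_sym oner_eq0.
by move=> i _; have := xi0 i; rewrite negbK => /eqP->; rewrite mul0r.
Qed.

Variables x0 xi : 'rV[R]_n.

Lemma continuous_phase : continuous (fun x : 'rV[R]_n => dotv xi (x - x0)).
Proof.
rewrite /dotv; apply: (@continuous_big R _ +%R 0 xpredT) => [|i _ x].
  exact: add_continuous.
have -> : (fun y : 'rV[R]_n => xi 0 i * (y - x0) 0 i) =
    (fun z : R => xi 0 i * (z - x0 0 i)) \o (fun M : 'rV[R]_n => M 0 i).
  by apply/funext => y /=; rewrite !mxE.
apply: continuous_comp; first exact: coord_continuous.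
by move=> z; apply: cvgM; [exact: cvg_cst|apply: cvgB; [exact: cvg_id|exact: cvg_cst]].
Qed.

(** Along the line [x + h v] the phase is affine in [h] with slope [dotv xi v], so the one-variable
    chain rule suffices. *)
Lemma is_derive_phase_comp (F : R -> R) (dF : R) (x v : 'rV[R]_n) :
  is_derive (dotv xi (x - x0)) 1 F dF ->
  is_derive x v (fun y => F (dotv xi (y - x0))) (dotv xi v * dF).
Proof.
move=> dF1; pose G (h : R) := h * dotv xi v + dotv xi (x - x0).
have dG : is_derive (0 : R) 1 G (dotv xi v).
  by apply: is_derive_eq; rewrite scaler0 add0r addr0 /GRing.scale/= mulr1.
have G0 : G 0 = dotv xi (x - x0) by rewrite /G mul0r add0r.
rewrite -G0 in dF1; have [dFG DFG] := is_derive1_comp dF1 dG.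
have FGE : (fun h : R => F (dotv xi (h *: v + x - x0))) = F \o G.
  by apply/funext => h /=; rewrite -addrA dotvD dotvZ.
apply: DeriveDef; first by apply/derivable1P; rewrite FGE.
(* [A] and [B] are the difference quotients in [x] along [v] and in [h] at [0]; they agree once
   [h * 1 + 0] is reduced to [h]. *)
rewrite mulrC -DFG /derive -FGE; set A := fun h => _; set B := fun h => _.
suff -> : A = B by [].
by apply/funext => h; rewrite /A /B /shift/= addr0 scale0r add0r -[h%:A]/(h * 1) mulr1.
Qed.

End MultiIndices.

(** * Superpositions of plane waves and their partial derivatives *)

Section PlaneWaves.
Variables (R : realType) (n : nat) (x0 xi : 'rV[R]_n) (phi : R -> R).
Hypothesis mphi : measurable_fun (`]0, +oo[ : set R) phi.
Hypothesis dphi : rapidly_decreasing phi.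

(** The phases [0] and [- (pi / 2)] will give the real and imaginary parts of the oscillatory
    integral. *)
Definition osc_wave theta (x : 'rV[R]_n) : R :=
  osc_moment phi 0 theta (dotv xi (x - x0)).

(** Each derivative in direction [i] brings out a factor [xi 0 i], raises the order of the moment by
    one and advances the phase by [pi / 2]. *)
Lemma partials_osc_wave theta (s : seq 'I_n) :
  partials s (osc_wave theta) = fun x => (\prod_(i <- s) xi 0 i) *
    osc_moment phi (size s) (theta + (size s)%:R * (pi / 2)) (dotv xi (x - x0)).
Proof.
elim: s => [|i s IHs] /=.
  by apply/funext => x; rewrite big_nil mul1r mul0r addr0.
rewrite IHs /partial; apply/funext => x.
have H := is_deriveZ (\prod_(j <- s) xi 0 j)
  (is_derive_phase_comp (x0 := x0)
  (xi := xi) (delta_mx 0 i) (is_derive_osc_moment mphi dphi (size s)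
  (theta + (size s)%:R * (pi / 2)) (dotv xi (x - x0)))).
have -> := @derive_val _ _ _ _ _ _ _ H.
have -> : theta + (size s)%:R * (pi / 2) + pi / 2 = theta + (size s).+1%:R * (pi / 2).
  by rewrite -[(size s).+1%:R]natr1; ring.
by rewrite big_cons dotv_delta /GRing.scale/= mulrCA mulrA.
Qed.

Lemma smooth_osc_wave theta : smooth_real setT (osc_wave theta).
Proof.
move=> s x _; rewrite partials_osc_wave; split.
  apply: (@continuous_comp _ _ _ (fun y : 'rV[R]_n => dotv xi (y - x0))
    (fun u => _ * osc_moment _ _ _ u)); first exact: continuous_phase.
  by apply: cvgM; [exact: cvg_cst|exact: continuous_osc_moment].
move=> i; have H := is_deriveZ (\prod_(j <- s) xi 0 j)
  (is_derive_phase_comp (x0 := x0)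
  (xi := xi) (delta_mx 0 i) (is_derive_osc_moment mphi dphi (size s)
  (theta + (size s)%:R * (pi / 2)) (dotv xi (x - x0)))).
exact: (@ex_derive _ _ _ _ _ _ _ H).
Qed.

Lemma multi_partial_osc_wave theta (alpha : {ffun 'I_n -> nat}) x :
  multi_partial alpha (osc_wave theta) x = (\prod_i xi 0 i ^+ alpha i) *
    osc_moment phi (mlen alpha) (theta + (mlen alpha)%:R * (pi / 2))
      (dotv xi (x - x0)).
Proof. by rewrite multi_partialE partials_osc_wave prod_index_seq size_index_seq. Qed.

End PlaneWaves.

(** * Log-convexity of the weights and estimates of [h_fun] *)

Section WeightSequenceTheory.
Variables (R : realType) (N : nat -> R).
Hypothesis hN : weight_sequence N.

Lemma weight_gt0 k : 0 < N k. Proof. by case: hN. Qed.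

Lemma mu_gt0 k : 0 < mu N k. Proof. by rewrite divr_gt0 ?weight_gt0. Qed.

Lemma mu_ge1 k : (1 <= k)%N -> 1 <= mu N k.
Proof.
case: hN => _ N0 N1 Nmu _ k1; apply: le_trans (Nmu 1%N k _); last by rewrite k1.
by rewrite /mu N0 divr1.
Qed.

Lemma weightS k : N k.+1 = mu N k.+1 * N k.
Proof. by rewrite /mu /= divfK// gt_eqF ?weight_gt0. Qed.

Lemma h_fun_lbound (t : R) : 0 < t -> lbound (range (fun k => t ^+ k * N k)) 0.
Proof. by move=> t0 _ [k _ <-]; rewrite mulr_ge0 ?exprn_ge0 ?ltW ?weight_gt0. Qed.

Lemma h_fun_le k (t : R) : 0 < t -> h_fun N t <= t ^+ k * N k.
Proof.
move=> t0; rewrite /h_fun t0; apply: ge_inf; last by exists k.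
by exists 0; exact: h_fun_lbound.
Qed.

Lemma h_fun_ge0 (t : R) : 0 <= h_fun N t.
Proof.
rewrite /h_fun; case: ifPn => // t0; apply: lb_le_inf; last exact: h_fun_lbound.
by exists (t ^+ 0 * N 0%N); exists 0%N.
Qed.

(** With [m = mu N k.+1], the sequence [N j / m ^ j] is minimal at [j = k]: its successive ratios
    [mu N j.+1 / m] are at most [1] before [k] and at least [1] from [k] on. *)
Lemma weight_log_convex k j : N k * mu N k.+1 ^+ j <= N j * mu N k.+1 ^+ k.
Proof.
have Nmu i l : (i <= l)%N -> mu N i.+1 <= mu N l.+1.
  by move=> il; case: hN => _ _ _ + _; apply; rewrite ltnS.
have m0 := ltW (mu_gt0 k.+1).
have [kj|/ltnW jk] := leqP k j.
- rewrite -(subnK kj); elim: (j - k)%N => [//|d IHd].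
  rewrite addSn exprS weightS mulrCA -mulrA; apply: ler_pM => //.
  + by rewrite mulr_ge0 ?exprn_ge0 ?ltW ?weight_gt0 ?mu_gt0.
  + exact/Nmu/leq_addl.
- have Nm d : (d + j <= k)%N -> N (d + j)%N <= N j * mu N k.+1 ^+ d.
    elim: d => [|d IHd] djk; first by rewrite mulr1.
    rewrite addSn weightS exprSr mulrA mulrC; apply: ler_pM.
    - exact/ltW/weight_gt0.
    - exact/ltW/mu_gt0.
    - exact/IHd/ltnW.
    - exact/Nmu/ltnW.
  have := Nm (k - j)%N; rewrite subnK// => /(_ (leqnn k)) Nkj.
  have -> : mu N k.+1 ^+ k = mu N k.+1 ^+ (k - j) * mu N k.+1 ^+ j.
    by rewrite -exprD subnK.
  by rewrite mulrA ler_wpM2r// exprn_ge0.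
Qed.

(** At [t = 1 / mu N k.+1] the infimum is attained at index [k], by [weight_log_convex]; a larger
    [t] only multiplies the term of index [j] by [(t * mu N k.+1) ^ j >= 1]. *)
Lemma h_fun_ge k (t : R) : 0 < t -> 1 <= t * mu N k.+1 ->
  N k / mu N k.+1 ^+ k <= h_fun N t.
Proof.
move=> t0 tmu; rewrite /h_fun t0; apply: lb_le_inf.
  by exists (t ^+ 0 * N 0%N); exists 0%N.
move=> _ [j _ <-]; have m0 := mu_gt0 k.+1.
rewrite ler_pdivrMr ?exprn_gt0// -mulrA.
rewrite -(@ler_pM2r _ (mu N k.+1 ^+ j)) ?exprn_gt0//.
apply: le_trans (weight_log_convex k j) _.
rewrite mulrAC -exprMn ler_peMl ?exprn_ege1//.
by rewrite mulr_ge0 ?exprn_ge0 ?ltW ?weight_gt0.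
Qed.

Lemma mu_le_expn :
  (ereal_sup [set (mu N k `^ k%:R^-1)%:E | k in [set k : nat | (1 <= k)%N]]
    < +oo)%E ->
  exists2 A : R, 1 <= A & forall k, (1 <= k)%N -> mu N k <= A ^+ k.
Proof.
set S := ereal_sup _ => Soo.
have leS k : (1 <= k)%N -> ((mu N k `^ k%:R^-1)%:E <= S)%E.
  by move=> k1; apply: ereal_sup_ubound; exists k.
have Sfin : S \is a fin_num.
  by rewrite fin_real// (lt_le_trans (ltNyr _) (leS 1%N isT)).
(* The maximum with [1] secures [A >= 1], so that powers of [A] may be inserted in later upper
   bounds. *)
exists (Num.max 1 (fine S)) => [|k k1]; first by rewrite le_max lexx.
have -> : mu N k = (mu N k `^ k%:R^-1) ^+ k.
  rewrite -powR_mulrn ?powR_ge0// -powRrM mulVf ?powRr1// ?ltW ?mu_gt0//.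
  by rewrite pnatr_eq0 -lt0n.
apply: lerXn2r; rewrite ?nnegrE ?powR_ge0 ?le_max ?ler01//.
by rewrite -[X in _ || X]lee_fin fineK// leS// orbT.
Qed.

(* Derivation closedness, in the form needed to absorb the two extra powers of
   [t] that make the moment integrals converge. *)
Lemma weight_shift2 (B : R) : 0 < B ->
  (ereal_sup [set (mu N k `^ k%:R^-1)%:E | k in [set k : nat | (1 <= k)%N]]
    < +oo)%E ->
  exists C h : R, [/\ 0 < C, 0 < h & forall k,
    B ^+ k * N k + B ^+ k.+2 * N k.+2 <= C * h ^+ k * N k].
Proof.
move=> B0 /mu_le_expn[A A1 muA]; have A0 := lt_le_trans ltr01 A1.
(* From [N (k+2) = mu (k+2) * mu (k+1) * N k <= A ^ (2k+3) * N k]: the part depending on [k] goes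
   into [h], the rest is [B ^ 2 * A ^ 3], and the summand [1] pays for [B ^ k * N k]. *)
exists (1 + B ^+ 2 * A ^+ 3), (B * A ^+ 2); split.
- by rewrite ltr_pwDl// mulr_ge0 ?exprn_ge0 ?ltW.
- by rewrite mulr_gt0 ?exprn_gt0.
move=> k; rewrite mulrDl mul1r mulrDl; have Nk := weight_gt0 k.
apply: lerD.
  rewrite ler_wpM2r ?(ltW Nk)// exprMn ler_peMr ?exprn_ge0 ?(ltW B0)//.
  by rewrite -exprM exprn_ege1.
have mu2 : mu N k.+2 * mu N k.+1 <= A ^+ k.+2 * A ^+ k.+1.
  by apply: ler_pM; rewrite ?muA// ltW// mu_gt0.
have -> : B ^+ k.+2 * N k.+2 = B ^+ k.+2 * (mu N k.+2 * mu N k.+1) * N k.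
  by rewrite weightS (weightS k); ring.
rewrite ler_pM2r//.
have -> : B ^+ 2 * A ^+ 3 * (B * A ^+ 2) ^+ k =
    B ^+ k.+2 * (A ^+ k.+2 * A ^+ k.+1).
  by rewrite exprMn -exprM mulnC exprM !exprS; ring.
by rewrite ler_pM2l ?exprn_gt0.
Qed.

End WeightSequenceTheory.

(** * Upper and lower bounds for the moments of a flat function *)

Section FlatMoments.
Variables (R : realType) (N : nat -> R) (phi : R -> R).
Hypothesis hN : weight_sequence N.
Local Notation mu := (@lebesgue_measure R).

(** Adding the bounds by the terms of index [k] and [k+2] of the infimum produces the factor
    [1 + t ^ 2]. The constant stays explicit because its growth in [k] decides the class. *)
Lemma flat_decay (A B : R) k : 0 < A -> 0 < B ->
  (forall t, 0 < t -> `|phi t| <= A * h_fun N (B / t)) ->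
  forall t, 0 < t ->
  `|phi t| * t ^+ k <= A * (B ^+ k * N k + B ^+ k.+2 * N k.+2) / oneDsqr t.
Proof.
move=> A0 B0 phih t t0.
have one0 : 0 < oneDsqr t by exact: lt_le_trans ltr01 (oneDsqr_ge1 t).
have le_pow j : `|phi t| * t ^+ j <= A * (B ^+ j * N j).
  rewrite -ler_pdivlMr ?exprn_gt0//; apply: (le_trans (phih t t0)).
  rewrite -!mulrA ler_pM2l// (le_trans (h_fun_le hN j (divr_gt0 B0 t0)))//.
  by rewrite expr_div_n mulrAC mulrA.
rewrite ler_pdivlMr// /oneDsqr mulrDr mulr1 -mulrA -exprD addn2 mulrDr.
exact: lerD.
Qed.

Lemma flat_rapidly_decreasing (A B : R) : 0 < A -> 0 < B ->
  (forall t, 0 < t -> `|phi t| <= A * h_fun N (B / t)) ->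
  rapidly_decreasing phi.
Proof.
by move=> A0 B0 phih k; eexists => t t0; exact: (flat_decay k A0 B0 phih t0).
Qed.

Definition moment k : R := \int[mu]_(t in `]0, +oo[) (phi t * t ^+ k).

Hypothesis mphi : measurable_fun (`]0, +oo[ : set R) phi.
Hypothesis dphi : rapidly_decreasing phi.

Lemma integrable_moment k :
  mu.-integrable `]0, +oo[ (EFin \o (fun t => phi t * t ^+ k)).
Proof.
have -> : (fun t => phi t * t ^+ k) = fun t => phi t * t ^+ k * cos (t * 0 + 0).
  by apply/funext => t; rewrite mulr0 addr0 cos0 mulr1.
exact: integrable_osc_moment.
Qed.

Lemma osc_moment0 k theta : osc_moment phi k theta 0 = cos theta * moment k.
Proof.
rewrite -RintegralZl//; last exact: integrable_moment.
by apply: eq_Rintegral => t _; rewrite mulr0 add0r mulrC.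
Qed.

(** As [phi >= 0], the integral may be restricted to []b / 2, b]], where the integrand is at least
    [c]; the length [b / 2 = (B / 2) * mu N k.+1] is at least [B / 2] and supplies the extra
    power. *)
Lemma moment_ge (A B : R) k : 0 < A -> 0 < B ->
  (forall t, 0 < t -> A * h_fun N (B / t) <= phi t) ->
  A * (B / 2) ^+ k.+1 * N k <= moment k.
Proof.
move=> A0 B0 hphi; have m0 := mu_gt0 hN k.+1; have Nk := weight_gt0 hN k.
have phi_ge0 t : 0 < t -> 0 <= phi t.
  by move=> t0; apply: le_trans (hphi t t0); rewrite mulr_ge0 ?h_fun_ge0// ltW.
pose b := B * Defs.mu N k.+1; have b0 : 0 < b by rewrite mulr_gt0.
have b20 : 0 < b / 2 by rewrite divr_gt0.
(* The product of [A * N k / mu ^ k], which bounds [phi] below, and [(b / 2) ^ k], which bounds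
   [t ^ k] below: the powers of [mu] cancel. *)
pose c := A * (B / 2) ^+ k * N k.
have c0 : 0 <= c by rewrite !mulr_ge0 ?exprn_ge0 ?divr_ge0 ?ltW.
have sub : `]b / 2, b] `<=` (`]0, +oo[ : set R).
  by move=> t; rewrite /= !in_itv/= andbT => /andP[/(lt_trans b20)].
have intI : mu.-integrable `]b / 2, b] (EFin \o (fun t => phi t * t ^+ k)).
  apply: (@integrableS _ _ _ mu `]0, +oo[) => //.
  exact: integrable_moment.
have mI : mu `]b / 2, b] = (b / 2)%:E.
  rewrite (lebesgue_measure_itv `]b / 2, b])/= lte_fin ifT.
    by rewrite -EFinB/=; congr (_%:E); field.
  by rewrite ltr_pdivrMr// mulr_natr mulr2n ltrDl.
have cI : \int[mu]_(t in `]b / 2, b]) c = c * (b / 2).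
  by rewrite Rintegral_cst//; congr (_ * _); exact: (congr1 fine mI).
apply: (@le_trans _ _ (c * (b / 2))).
  rewrite /c /b exprSr; set x := (B / 2) ^+ k.
  have -> : A * x * N k * (B * Defs.mu N k.+1 / 2) =
     A * (x * (B / 2)) * N k * Defs.mu N k.+1 by ring.
  rewrite ler_peMr ?mu_ge1//.
  by rewrite !mulr_ge0 ?exprn_ge0 ?divr_ge0 ?ltW.
rewrite -cI; apply: (@le_trans _ _ (\int[mu]_(t in `]b / 2, b]) (phi t * t ^+ k))).
  apply: le_Rintegral => //.
    apply: measurable_bounded_integrable => //.
    - exact: (eq_ind_r (fun x => (x < +oo)%E) (ltry (b / 2)) mI).
    - exact: bounded_cst.
  move=> t; rewrite /= in_itv/= => /andP[bt tb]; have t0 := lt_trans b20 bt.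
  have tB : 1 <= B / t * Defs.mu N k.+1.
    by rewrite mulrAC ler_pdivlMr// mul1r.
  have ht := h_fun_ge hN (divr_gt0 B0 t0) tB.
  apply: (@le_trans _ _ (A * (N k / Defs.mu N k.+1 ^+ k) * (b / 2) ^+ k)).
    have cE m : 0 < m -> c = A * (N k / m ^+ k) * (B * m / 2) ^+ k.
      move=> m_gt0; rewrite /c !exprMn.
      by field; rewrite expf_neq0// gt_eqF.
    by rewrite -(cE _ m0).
  apply: ler_pM.
  - by rewrite mulr_ge0 ?divr_ge0 ?exprn_ge0 ?ltW.
  - by rewrite exprn_ge0// ltW.
  - by apply: le_trans (hphi t t0); rewrite ler_pM2l.
  - by apply: lerXn2r; rewrite ?nnegrE ltW.
(* Enlarging the domain is done on extended-real integrals of a nonnegative function; finiteness of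
   both permits the return to [R]. *)
rewrite /moment /Rintegral fine_le//.
- exact: integrable_fin_num.
- by apply: integrable_fin_num => //; exact: integrable_moment.
- apply: ge0_subset_integral => //.
    exact: measurable_int (integrable_moment k).
  move=> t; rewrite /= in_itv/= andbT => t0.
  by rewrite lee_fin mulr_ge0 ?phi_ge0 ?exprn_ge0 ?ltW.
Qed.

End FlatMoments.

(** * Norm bounds in [R[i]], and measurability of a flat function along the ray of argument zero *)

Section FlatFunctionTheory.
Variable R : realType.
Implicit Types (z : R[i]) (t s : R).

Lemma normc_Re_le z (c : R) : `|z| <= c%:C%C -> `|complex.Re z| <= c.
Proof.
rewrite normc_def lecR; apply: le_trans.
by rewrite -sqrtr_sqr ler_wsqrtr// lerDl sqr_ge0.
Qed.

Lemma normc_le_add (a b c : R) : `|a| <= c -> `|b| <= c ->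
  `|(a +i* b)%C| <= (2 * c)%:C%C.
Proof.
move=> ac bc; rewrite normc_def lecR/=.
have ab0 : 0 <= `|a| + `|b| by rewrite addr_ge0.
apply: (@le_trans _ _ (`|a| + `|b|)); last by rewrite mulr_natl mulr2n lerD.
rewrite -[leRHS]ger0_norm// -sqrtr_sqr ler_wsqrtr//.
rewrite sqrrD !real_normK ?num_real// lerD2r lerDl.
by rewrite mulrn_wge0// mulr_ge0.
Qed.

Lemma continuous_Re_real (H : R[i]^o -> R[i]^o) s :
  {for (s%:C%C : R[i]^o), continuous H} ->
  {for s, continuous (fun r : R => complex.Re (H r%:C%C))}.
Proof.
move=> cH; apply/cvgrPdist_lt => e e0.
have e0C : 0 < e%:C%C by rewrite ltcR.
move/cvgrPdist_lt : cH => /(_ _ e0C) /nbhs_ballP[[d b] /= d0 dH].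
(* Radii of balls lie in [R[i]]; positivity in the partial order forces this one to be real. *)
move: d0 dH; rewrite ltcE/= => /andP[/eqP -> d0] dH.
near=> r.
have : ball (s%:C%C : R[i]^o) (d +i* 0)%C (r%:C%C).
  rewrite -ball_normE /= -rmorphB normc_def/= expr0n addr0 sqrtr_sqr ltcR.
  by near: r; apply: cvgr_dist_lt.
move=> /dH; rewrite normc_def ltcR; apply: le_lt_trans.
rewrite -sqrtr_sqr ler_wsqrtr// !raddfB/= lerDl.
by rewrite sqr_ge0.
Unshelve. all: by end_near. Qed.

(** Measurability comes from continuity: [G] is differentiable in the logarithmic chart, and [1 / t]
    corresponds to the real chart point [- ln t]. *)
Lemma measurable_flat gamma (G : R * R -> R[i]) : 0 < gamma ->
  holomorphic_on_sector gamma G ->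
  measurable_fun (`]0, +oo[ : set R) (fun t => complex.Re (Phi_of G t)).
Proof.
move=> gamma0 hG; apply: open_continuous_measurable_fun.
  exact: interval_open.
move=> t; rewrite inE/= in_itv/= andbT => t0.
pose F (s : R) := complex.Re (G (log_surface_exp s%:C%C)).
have cF s : {for s, continuous F}.
  have : {for (s%:C%C : R[i]^o),
      continuous ((G \o @log_surface_exp R) : R[i]^o -> R[i]^o)};
    last exact: continuous_Re_real.
  apply: differentiable_continuous; apply/derivable1_diffP; apply: hG.
  by split; rewrite /= ?expR_gt0// normr0 !(mulr_gt0, divr_gt0, pi_gt0).
have cFln : {for t, continuous (F \o (fun r => - ln r))}.
  apply: continuous_comp; last exact: cF.
  by apply: cvgN; exact: continuous_ln.
have E : {near t, F \o (fun r => - ln r) =1 fun r => complex.Re (Phi_of G r)}.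
  near=> r; rewrite /F /Phi_of /log_surface_exp/= expRN lnK// posrE.
  by near: r; exact: lt_nbhsr.
rewrite /continuous_at -(nbhs_singleton E).
exact: cvg_trans (near_eq_cvg E) cFln.
Unshelve. all: by end_near. Qed.

End FlatFunctionTheory.

(** * The oscillatory integral: regularity, membership in the class, and optimality *)

Section OscillatoryWaves.
Variables (R : realType) (n : nat) (N : nat -> R) (gamma : R).
Variables (G : R * R -> R[i]) (x0 xi0 : 'rV[R]_n).
Hypotheses (hN : weight_sequence N) (gamma0 : 0 < gamma).
Hypothesis hG : optimal_flat N gamma G.
Local Notation phi := (fun t : R => complex.Re (Phi_of G t)).

(** The flatness bounds are read at modulus [1 / t] and argument [0]; a lower bound in the partial
    order of [R[i]] also makes the imaginary part vanish. *)
Lemma optimal_flat_bounds : exists A1 B1 A2 B2 : R,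
  [/\ [/\ 0 < A1, 0 < B1, 0 < A2 & 0 < B2],
      forall t, 0 < t -> complex.Im (Phi_of G t) = 0,
      forall t, 0 < t -> A1 * h_fun N (B1 / t) <= phi t
    & forall t, 0 < t -> `|phi t| <= A2 * h_fun N (B2 / t)].
Proof.
case: hG => _ [A1 [B1 [A2 [B2 [AB lbG ubG]]]]].
exists A1, B1, A2, B2; split=> // t t0; have tV0 : 0 < t^-1 by rewrite invr_gt0.
- by have := lbG _ tV0; rewrite lecE => /andP[/eqP].
- by have := lbG _ tV0; rewrite lecE => /andP[].
- apply/normc_Re_le/ubG; split => //=.
  by rewrite normr0 !(mulr_gt0, divr_gt0, pi_gt0).
Qed.

Let mphi : measurable_fun (`]0, +oo[ : set R) phi.
Proof. by case: hG => hol _; exact: measurable_flat hol. Qed.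

Let dphi : rapidly_decreasing phi.
Proof.
have [A1 [B1 [A2 [B2 [[_ _ A20 B20] _ _ phi_le]]]]] := optimal_flat_bounds.
exact: flat_rapidly_decreasing phi_le.
Qed.

Lemma osc_integrandE (x : 'rV[R]_n) t : 0 < t ->
  osc_integrand G x0 xi0 x t =
    Complex (phi t * t ^+ 0 * cos (t * dotv xi0 (x - x0) + 0))
            (phi t * t ^+ 0 * cos (t * dotv xi0 (x - x0) - pi / 2)).
Proof.
move=> t0; have [A1 [B1 [A2 [B2 [_ Im0 _ _]]]]] := optimal_flat_bounds.
rewrite cosBpihalf addr0 !mulr1 /osc_integrand /expi.
have := Im0 t t0; case: (Phi_of G t) => a b /= ->.
have -> c d : Complex a 0 * Complex c d = Complex (a * c - 0 * d) (a * d + 0 * c) by [].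
by rewrite !mul0r subr0 addr0.
Qed.

(** Shows that [osc_integral] is a convergent integral, since the formal integral is a total
    operation. *)
Lemma cintegrable_osc_integrand x :
  cintegrable `]0, +oo[ (osc_integrand G x0 xi0 x).
Proof.
split.
- have := integrable_osc_moment mphi dphi 0 0 (dotv xi0 (x - x0)).
  apply: eq_integrable => // t; rewrite inE/= in_itv/= andbT => t0.
  by rewrite osc_integrandE.
- have := integrable_osc_moment mphi dphi 0 (- (pi / 2)) (dotv xi0 (x - x0)).
  apply: eq_integrable => // t; rewrite inE/= in_itv/= andbT => t0.
  by rewrite osc_integrandE.
Qed.

Lemma Re_osc_integral :
  @complex.Re R \o osc_integral G x0 xi0 = osc_wave x0 xi0 phi 0.
Proof.
apply/funext => x /=; apply: eq_Rintegral => t.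
by rewrite inE/= in_itv/= andbT => t0; rewrite osc_integrandE.
Qed.

Lemma Im_osc_integral :
  @complex.Im R \o osc_integral G x0 xi0 = osc_wave x0 xi0 phi (- (pi / 2)).
Proof.
apply/funext => x /=; apply: eq_Rintegral => t.
by rewrite inE/= in_itv/= andbT => t0; rewrite osc_integrandE.
Qed.

Lemma smooth_osc_integral : smooth setT (osc_integral G x0 xi0).
Proof.
by rewrite /smooth Re_osc_integral Im_osc_integral; split; exact: smooth_osc_wave.
Qed.

Hypothesis hxi0 : norm2 xi0 = 1.

Lemma ultra_class_osc_integral :
  (ereal_sup [set (mu N k `^ k%:R^-1)%:E | k in [set k : nat | (1 <= k)%N]]
    < +oo)%E ->
  ultra_class N setT (osc_integral G x0 xi0).
Proof.
move=> hdc; split; first exact: smooth_osc_integral.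
move=> K _ _.
have [A1 [B1 [A2 [B2 [[_ _ A20 B20] _ _ phi_le]]]]] := optimal_flat_bounds.
have [C [h [C0 h0 NC]]] := weight_shift2 hN B20 hdc.
(* The factor [2] combines real and imaginary parts, and [pi / 2] is the integral of
   [1 / (1 + t ^ 2)]. The bound is uniform in [x], so the same constants serve every compact set. *)
exists (2 * (A2 * C * (pi / 2))), h; split=> //.
  by rewrite !mulr_gt0 ?pi_gt0// divr_gt0 ?pi_gt0.
move=> alpha x _; set m := mlen alpha.
have bound theta : `|multi_partial alpha (osc_wave x0 xi0 phi theta) x| <=
    A2 * C * (pi / 2) * h ^+ m * N m.
  rewrite multi_partial_osc_wave// normrM.
  apply: (@le_trans _ _ (A2 * (B2 ^+ m * N m + B2 ^+ m.+2 * N m.+2) * (pi / 2))).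
    rewrite -[leRHS]mul1r; apply: ler_pM => //.
      rewrite normr_prod prodr_ile1// => i _.
      by rewrite normrX exprn_ge0// exprn_ile1 ?norm_coord_le1.
    by apply: osc_moment_le => // t t0; exact: flat_decay phi_le _ t0.
  have -> : A2 * C * (pi / 2) * h ^+ m * N m = A2 * (C * h ^+ m * N m) * (pi / 2).
    by ring.
  by rewrite ler_pM2r ?divr_gt0 ?pi_gt0// ler_pM2l.
rewrite /multi_partialC Re_osc_integral Im_osc_integral -!(mulrA 2).
by apply: normc_le_add; exact: bound.
Qed.

(** At [x0] the phase vanishes, so the real and imaginary parts are the cosine and sine of the
    single angle [k * (pi / 2)] times the same real number. *)
Lemma norm_multi_partialC_at_center (j : 'I_n) k :
  `|multi_partialC [ffun i => if i == j then k else 0%N]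
      (osc_integral G x0 xi0) x0|
    = (`|xi0 0 j| ^+ k * `|moment phi k|)%:C%C.
Proof.
set alpha := finfun _.
have alphaE i : alpha i = if i == j then k else 0%N by rewrite ffunE.
have lenE : mlen alpha = k.
  rewrite /mlen (bigD1 j)//= alphaE eqxx big1 ?addn0// => i ij.
  by rewrite alphaE (negPf ij).
have prodE : \prod_i xi0 0 i ^+ alpha i = xi0 0 j ^+ k.
  rewrite (bigD1 j)//= alphaE eqxx big1 ?mulr1// => i ij.
  by rewrite alphaE (negPf ij).
have phase0 : dotv xi0 (x0 - x0) = 0.
  by rewrite subrr -(scale0r x0) dotvZ mul0r.
rewrite /multi_partialC Re_osc_integral Im_osc_integral.
rewrite !multi_partial_osc_wave// lenE prodE phase0 !osc_moment0//.
rewrite normc_def/= add0r [- _ + _]addrC cosBpihalf; congr (_%:C%C).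
set c := cos _; set s := sin _.
have -> : (xi0 0 j ^+ k * (c * moment phi k)) ^+ 2 +
    (xi0 0 j ^+ k * (s * moment phi k)) ^+ 2 =
    (xi0 0 j ^+ k * moment phi k) ^+ 2.
  rewrite -[RHS]mulr1 -(cos2Dsin2 (k%:R * (pi / 2))) -/c -/s; ring.
by rewrite sqrtr_sqr normrM normrX.
Qed.

Lemma seq_le_of_ultra_class (T : nat -> R) :
  ultra_class T setT (osc_integral G x0 xi0) -> seq_le N T.
Proof.
have [A1 [B1 [A2 [B2 [[A10 B10 _ _] _ phi_ge _]]]]] := optimal_flat_bounds.
move=> [_ /(_ [set x0])]; case=> [|//|C [h [C0 h0 CT]]].
  exact: compact_set1.
have [j xij] := norm2_1_neq0 hxi0.
pose a := `|xi0 0 j|; have a0 : 0 < a by rewrite normr_gt0.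
pose q := B1 / 2; have q0 : 0 < q by rewrite divr_gt0.
(* These solve [a ^ k * (A1 * q ^ (k+1) * N k) <= C * h ^ k * T k] for [N k]; the left side is the
   lower bound of the [k]-th derivative in direction [j] at [x0]. *)
exists (C / (A1 * q)), (h / (a * q)); split.
- by rewrite divr_gt0 ?mulr_gt0.
- by rewrite divr_gt0 ?mulr_gt0.
move=> k; have := CT [ffun i => if i == j then k else 0%N] x0 erefl.
have -> : mlen [ffun i => if i == j then k else 0%N] = k.
  rewrite /mlen (bigD1 j)//= ffunE eqxx big1 ?addn0// => i ij.
  by rewrite ffunE (negPf ij).
rewrite norm_multi_partialC_at_center lecR => leT.
have leN : a ^+ k * (A1 * q ^+ k.+1 * N k) <= C * h ^+ k * T k.
  apply: le_trans leT; rewrite ler_pM2l ?exprn_gt0//.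
  apply: le_trans (ler_norm _); exact: moment_ge.
have -> : C / (A1 * q) * (h / (a * q)) ^+ k * T k =
    (C * h ^+ k * T k) / (A1 * q * (a * q) ^+ k).
  by rewrite expr_div_n; field; rewrite ?gt_eqF ?exprn_gt0 ?mulr_gt0.
rewrite ler_pdivlMr ?mulr_gt0 ?exprn_gt0 ?mulr_gt0//.
by apply: le_trans leN; rewrite exprMn exprS le_eqVlt; apply/orP; left;
   apply/eqP; ring.
Qed.

End OscillatoryWaves.

Theorem mainTheorem5 (R : realType) (N : nat -> R) (hN : weight_sequence N)
    (hdc : (ereal_sup [set (mu N k `^ k%:R^-1)%:E
                      | k in [set k : nat | (1 <= k)%N]] < +oo)%E)
    (hgammaN : (0 < gamma_index N)%E)
    (gamma : R) (hgamma0 : 0 < gamma) (hgamma : (gamma%:E < gamma_index N)%E)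
    (G : R * R -> R[i]) (hG : optimal_flat N gamma G)
    (n : nat) (x0 xi0 : 'rV[R]_n) (hxi0 : norm2 xi0 = 1) :
  (forall x : 'rV[R]_n, cintegrable `]0, +oo[ (osc_integrand G x0 xi0 x)) /\
  smooth setT (osc_integral G x0 xi0) /\
  optimal_function N setT (osc_integral G x0 xi0).
Proof.
split; first by move=> x; exact: cintegrable_osc_integrand hN hgamma0 hG x.
have sg := smooth_osc_integral x0 xi0 hN hgamma0 hG.
split=> //; split=> //; first exact: ultra_class_osc_integral hG hxi0 hdc.
move=> T _ [_ nNT] gT; apply: nNT.
exact: seq_le_of_ultra_class hG hxi0 T gT.
Qed.
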